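(* Assume that $\mathcal{B}$ is a Hilbert space and $Z$ is a densely defined dissipative linear operator in $\mathcal{B}$. Then there exists a function $F\in\mathcal{F}_{\mathcal{B}}$ such that $F'(0)|_{\mathcal{D}(Z)}=Z$ (i.e. $\mathcal{D}(Z)\subset\mathcal{D}(F'(0))$ and $F'(0)g=Zg$ for $g\in\mathcal{D}(Z)$). Moreover, for such $F$, if $l>0$ and there exists a local solution $f:[0,l)\to\mathcal{B}$ of the system $$f'(t)=\overline{Z}f(t),\ t\in[0,l),\qquad f(0)=h\in\mathcal{D}(\overline{Z}),$$ then $F(\tfrac tn)^nh$ tends to $f(t)$ as $n\to\infty$ uniformly with respect to $t\in[0,t_0]$ for any $t_0\in(0,l)$.
   Context: $\mathcal{B}$ is over $\mathbb{R}$ or $\mathbb{C}$, with its norm topology. $\mathcal{L}(\mathcal{B})$ is the space of bounded linear operators in $\mathcal{B}$ with the topology of pointwise convergence; $I$ is the identity; $\mathcal{D}(C)$ is the domain of $C$. For $F:[0,\infty)\to\mathcal{L}(\mathcal{B})$ and $s\ge0$ put $\mathbf{B}^F_s=\{F(\tfrac dn)^m : md/n\le s,\ n,m\in\mathbb{N},\ d\ge0\}$. $\mathcal{E}_{\mathcal{B}}$ is the set of $F:[0,\infty)\to\mathcal{L}(\mathcal{B})$ with $F(0)=I$ and $\mathbf{B}^F_s$ equicontinuous (i.e. uniformly bounded in operator norm) for every $s\ge0$. $\mathcal{D}(F'_{mef}(0))$ is the set of $f\in\mathcal{B}$ for which there is a family $\{f_s\}_{s\ge0}$ in $\mathcal{B}$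 such that $\lim_{h\to0}f_h=f$ and $\lim_{h\to0}h^{-1}(F(h)-F(0))f_h$ exists (limits as $h\to0$, $h>0$). $\mathcal{F}_{\mathcal{B}}$ is the set of $F\in\mathcal{E}_{\mathcal{B}}$ with $\mathcal{D}(F'_{mef}(0))$ dense in $\mathcal{B}$. The strong derivative $F'(0)$ of $F$ at $0$ is $F'(0)\psi=\lim_{h\to0}h^{-1}(F(h)\psi-F(0)\psi)$, with domain $\mathcal{D}(F'(0))$ the set of all $\psi\in\mathcal{B}$ for which this limit exists. $Z$ is dissipative if $\operatorname{Re}\langle Zx,x\rangle\le0$ for all $x\in\mathcal{D}(Z)$. $\overline{Z}$ denotes the closure of $Z$ (the operator whose graph is the closure of the graph of $Z$ in $\mathcal{B}\times\mathcal{B}$); densely defined dissipative operators are closable. A function $g:[0,l)\to\mathcal{B}$, $l>0$, is a local solution of $f'=\overline{Z}f$ on $[0,l)$, $f(0)=h\in\mathcal{D}(\overline{Z})$, if $g(s)\in\mathcal{D}(\overline{Z})$ for all $s\in[0,l)$, $g(0)=h$, and $g'(s)=\overline{Z}g(s)$ for all $s\in[0,l)$ (one-sided derivative at $0$). *)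

(* Defs.v *)
From HB Require Import structures.
From mathcomp Require Import all_boot all_order all_algebra.
From mathcomp Require Import sesquilinear complex.
From mathcomp Require Import all_classical all_reals all_analysis.

Set Implicit Arguments.
Unset Strict Implicit.
Unset Printing Implicit Defensive.
Import Order.TTheory GRing.Theory Num.Theory.
Import numFieldNormedType.Exports.
Local Open Scope classical_set_scope.
Local Open Scope ring_scope.

(* The scalar field K is the field R of real numbers or the field R[i] of      *)
(* complex numbers, given with the embedding of R, conjugation and real part.  *)
(* Times are elements of R, and they act on vectors through the embedding.     *)
Variant scalar_field (R : realType) : forall K : numFieldType,
    {rmorphism R -> K} -> {rmorphism K -> K} -> (K -> R) -> Prop :=
  | real_scalars : @scalar_field R R idfun idfun idfun
  | complex_scalars :
      @scalar_field R R[i] (real_complex R) Num.conj (@complex.Re R).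

(* A complete normed space is a Hilbert space when its norm comes from an      *)
(* inner product, here linear in its first argument.                           *)
Definition induces_norm (K : numFieldType) (B : completeNormedModType K)
    (conj : {rmorphism K -> K}) (ip : {dot B for conj}) : Prop :=
  forall x : B, ip x x = `|x| ^+ 2.

(* Operators in B with a domain are identified with their graphs, subsets of   *)
(* B * B; the closure of an operator is then the topological closure of its    *)
(* graph.                                                                      *)
Section Operators.
Variables (K : numFieldType) (B : completeNormedModType K).
Implicit Types Z : set (B * B).

Definition dom Z : set B := [set x | exists y, Z (x, y)].

Definition linear_operator Z : Prop :=
  [/\ Z 0,
      forall (a : K) (p q : B * B), Z p -> Z q -> Z (a *: p + q)
    & forall x y z : B, Z (x, y) -> Z (x, z) -> y = z].

Definition restrict Z (D : set B) : set (B * B) := [set p | Z p /\ D p.1].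

Definition dissipative (R : realType) (re : K -> R)
    (conj : {rmorphism K -> K}) (ip : {dot B for conj}) Z : Prop :=
  forall x y : B, Z (x, y) -> re (ip y x) <= 0.

End Operators.

(* Functions on [0, oo[ and [0, l[ are total on R; their values at other       *)
(* points play no role.                                                        *)
Section OperatorFunctions.
Variables (R : realType) (K : numFieldType) (iota : {rmorphism R -> K}).
Variable B : completeNormedModType K.
Implicit Types F : R -> {linear B -> B}.

Definition powers F (s : R) : set (B -> B) :=
  [set T | exists (n m : nat) (d : R),
    [/\ (0 < n)%N, 0 <= d, m%:R * d / n%:R <= s
      & T = iter m (F (d / n%:R))]].

Definition class_E F : Prop :=
  [/\ forall t : R, 0 <= t -> bounded_near (F t) (nbhs (0 : B)),
      forall x : B, F 0 x = x
    & forall s : R, 0 <= s -> equicontinuous (powers F s) id].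

Definition dom_mef F : set B :=
  [set f | exists f_ : R -> B,
    f_ h @[h --> 0^'+] --> f /\
    exists y : B,
      (iota h)^-1 *: (F h (f_ h) - F 0 (f_ h)) @[h --> 0^'+] --> y].

Definition class_F F : Prop := class_E F /\ dense (dom_mef F).

(* The graph of the strong derivative F'(0). *)
Definition strong_derivative0 F : set (B * B) :=
  [set p | (iota h)^-1 *: (F h p.1 - F 0 p.1) @[h --> 0^'+] --> p.2].

Definition extends_generator F (Z : set (B * B)) : Prop :=
  dom Z `<=` dom (strong_derivative0 F) /\
  restrict (strong_derivative0 F) (dom Z) = Z.

(* y is the derivative at s of g : [0, l[ -> B, one-sided when s = 0. *)
Definition derivative_on (l : R) (g : R -> B) (s : R) (y : B) : Prop :=
  (iota (t - s))^-1 *: (g t - g s) @[t --> within `[0, l[ s^'] --> y.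

Definition local_solution (A : set (B * B)) (l : R) (h : B) (g : R -> B) :
    Prop :=
  [/\ dom A h, g 0 = h
    & forall s : R, 0 <= s < l ->
        exists2 y : B, A (g s, y) & derivative_on l g s y].

End OperatorFunctions.

(* Main.v *)
Require Import Defs.
From HB Require Import structures.
From mathcomp Require Import all_boot all_order all_algebra.
From mathcomp Require Import sesquilinear complex.
From mathcomp Require Import all_classical all_reals all_analysis.
From mathcomp Require Import ring lra.
Set Implicit Arguments.
Unset Strict Implicit.
Unset Printing Implicit Defensive.
Import Order.TTheory GRing.Theory Num.Theory.
Import numFieldNormedType.Exports.
Local Open Scope classical_set_scope.
Local Open Scope ring_scope.

(** For t >= 0, dissipativity makes x - t Zx |-> x a contraction on the range
    of I - tZ; extending it by 0 on the orthogonal complement of this range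
    gives a contraction F(t) of the whole space, with
    (F(t)x - x) / t = F(t)Zx --> Zx on the domain of Z.  No maximal
    dissipative extension of Z is needed.

    For the convergence, F(t/n)^n h is compared with a solution f that is only
    differentiable, so f' may be unbounded and the usual Chernoff telescoping
    with a uniform o(t/n) is not available.  Instead, every s in [0, t0] has
    its own gauge radius within which f(x) = f(s) + (x - s)f'(s) + O(e|x - s|)
    and F(t)^i f(s) = f(s) + i t f'(s) + O(e i t) + o(1), the latter by
    approximating (f(s), f'(s)) with points of the graph of Z.  The error
    F(t)^j (F(t)^k h - f(kt)), whose bound must hold for all j so that the
    constant M bounding the powers of F is paid only once, thus grows by at
    most C e (b - a) over an interval [a, b] inside the gauge of s in [a, b],
    and real induction yields a total error C e t0. *)

(** * Real and complex scalars treated uniformly, and the norm with real values *)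

Section ScalarField.
Variables (R : realType) (K : numFieldType).
Variables (iota : {rmorphism R -> K}) (conj : {rmorphism K -> K}) (re : K -> R).
Hypothesis hK : scalar_field iota conj re.

Lemma re_iota r : re (iota r) = r.
Proof. by case: hK. Qed.

Lemma re0 : re 0 = 0.
Proof. by rewrite -(rmorph0 iota) re_iota. Qed.

Lemma reD : {morph re : x y / x + y}.
Proof. by case: hK => // -[a b] [c d]. Qed.

Lemma re_iotaM r z : re (iota r * z) = r * re z.
Proof. by case: hK z => //= -[a b] /=; rewrite mul0r subr0. Qed.

Lemma re_conj z : re (conj z) = re z.
Proof. by case: hK z => // -[a b]. Qed.

Lemma conjK : involutive conj.
Proof. by case: hK => // z; rewrite /= conjCK. Qed.

Lemma iota_re_ge0 z : 0 <= z -> iota (re z) = z.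
Proof.
case: hK z => // z /ger0_real z0.
by rewrite /= RRe_real.
Qed.

Lemma ler_iota r s : (iota r <= iota s) = (r <= s).
Proof. by case: hK => //=; rewrite lecR. Qed.

Lemma ltr_iota r s : (iota r < iota s) = (r < s).
Proof. by case: hK => //=; rewrite ltcR. Qed.

Lemma norm_iota r : `|iota r| = iota `|r|.
Proof.
case: (ger0P r) => r0; first by rewrite ger0_norm// -(rmorph0 iota) ler_iota.
by rewrite ltr0_norm ?rmorphN// -(rmorph0 iota) ltr_iota.
Qed.

Lemma iota_gt0 (e : K) : 0 < e -> exists2 d, 0 < d & iota d = e.
Proof.
move=> e0; exists (re e); last by rewrite iota_re_ge0// ltW.
by rewrite -ltr_iota rmorph0 iota_re_ge0// ltW.
Qed.

Section Norm.
Variable B : completeNormedModType K.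
Implicit Types x y : B.

(** The norm of [B] takes its values in [K]; its real part lets all estimates be carried out in the
    ordered field [R]. *)
Definition rnorm x : R := re `|x|.
Local Notation N := rnorm.

Lemma iota_rnorm x : iota (N x) = `|x|.
Proof. by rewrite iota_re_ge0. Qed.

Lemma rnorm_ge0 x : 0 <= N x.
Proof. by rewrite -ler_iota iota_rnorm rmorph0. Qed.

Lemma rnorm0 : N 0 = 0.
Proof. by rewrite /N normr0 -(rmorph0 iota) re_iota. Qed.

Lemma rnorm_eq0 x : N x = 0 -> x = 0.
Proof. by move=> h; apply/eqP; rewrite -normr_eq0 -iota_rnorm h rmorph0. Qed.

Lemma rnormN x : N (- x) = N x.
Proof. by rewrite /N normrN. Qed.

Lemma rnormBC x y : N (x - y) = N (y - x).
Proof. by rewrite -opprB rnormN. Qed.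

Lemma rnormD x y : N (x + y) <= N x + N y.
Proof. by rewrite -ler_iota rmorphD /= !iota_rnorm ler_normD. Qed.

Lemma rnormB x y : N (x - y) <= N x + N y.
Proof. by rewrite -(rnormN y) rnormD. Qed.

Lemma rnormZr (a : K) x : N (a *: x) = re `|a| * N x.
Proof. by rewrite /N normrZ -{1}(iota_re_ge0 (normr_ge0 a)) re_iotaM. Qed.

Lemma rnormZ r x : N (iota r *: x) = `|r| * N x.
Proof. by rewrite /N normrZ norm_iota re_iotaM. Qed.

Lemma cvg_rnormP (T : Type) (G : set_system T) (FG : Filter G) (f : T -> B) y :
  f @ G --> y <-> forall e, 0 < e -> \forall t \near G, N (y - f t) < e.
Proof.
split=> [/cvgrPdist_lt fy e e0|fy].
  have e0' : 0 < iota e by rewrite -(rmorph0 iota) ltr_iota.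
  apply: filterS (fy _ e0') => t.
  by rewrite -iota_rnorm ltr_iota.
apply/cvgrPdist_lt => e /iota_gt0[d d0 <-].
apply: filterS (fy _ d0) => t.
by rewrite -iota_rnorm ltr_iota.
Qed.

Lemma rnorm_near x e : 0 < e -> \forall y \near x, N (x - y) < e.
Proof. by move=> e0; apply: ((cvg_rnormP _ id x).1 _ e e0); exact: cvg_id. Qed.

End Norm.
End ScalarField.

(** * Density, closure and derivatives in terms of the real norm *)

Section RealNormTopology.
Variables (R : realType) (K : numFieldType).
Variables (iota : {rmorphism R -> K}) (conj : {rmorphism K -> K}) (re : K -> R).
Hypothesis hK : scalar_field iota conj re.
Variable B : completeNormedModType K.
Implicit Types (x y : B) (r s t a b d e eta : R).
Local Notation N := (rnorm re).
Local Notation "r ** x" := (iota r *: x) (at level 40).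

Lemma dense_rnorm (D : set B) x e : dense D -> 0 < e ->
  exists2 g, D g & N (x - g) < e.
Proof.
move=> Dd e0; have : nbhs x [set y | N (x - y) < e] by exact: (rnorm_near hK).
rewrite nbhsE => -[U [Uo Ux] Ue].
have [|g [Ug Dg]] := Dd U _ Uo; first by exists x.
by exists g => //; exact: Ue.
Qed.

Lemma closure_rnorm (Z : set (B * B)) x y e : closure Z (x, y) -> 0 < e ->
  exists g z, [/\ Z (g, z), N (x - g) < e & N (y - z) < e].
Proof.
move=> Zxy e0.
have [|[g z] [Zgz [/= xg yz]]] :=
    Zxy [set p | N (x - p.1) < e /\ N (y - p.2) < e].
  exists ([set u | N (x - u) < e], [set u | N (y - u) < e]) => //=.
  by split; exact: (rnorm_near hK).
by exists g, z.
Qed.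

Lemma nbhs_rnorm x (A : set B) : nbhs x A ->
  exists2 e, 0 < e & forall y, N (x - y) < e -> A y.
Proof.
move=> /nbhs_normP[_ /(iota_gt0 hK)[e e0 <-] eA]; exists e => // y xy.
by apply: eA; rewrite /= -(iota_rnorm hK) (ltr_iota hK).
Qed.

Lemma closure_rnormP (Z : set (B * B)) x y : closure Z (x, y) <->
  forall e, 0 < e -> exists g z, [/\ Z (g, z), N (x - g) < e & N (y - z) < e].
Proof.
split=> [Zxy e|Zxy U [[A C] [/= /nbhs_rnorm[a a0 xA] /nbhs_rnorm[c c0 yC] ACU]]].
  exact: closure_rnorm.
have [|g [z [Zgz xg yz]]] := Zxy (Num.min a c); first by rewrite lt_min a0.
exists (g, z); split=> //; apply: ACU; split=> /=.
  by apply: xA; rewrite (lt_le_trans xg)// ge_min lexx.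
by apply: yC; rewrite (lt_le_trans yz)// ge_min lexx orbT.
Qed.

Lemma near_right0P (P : set R) : (\forall t \near 0^'+, P t) <->
  exists2 d, 0 < d & forall t, 0 < t < d -> P t.
Proof.
split=> [|[d d0 dP]].
  rewrite near_withinE near_nbhs_norm => -[d /= d0 dP]; exists d => // t /andP[t0 td].
  by apply: dP => //=; rewrite sub0r normrN gtr0_norm.
near=> t; apply: dP; apply/andP; split; near: t.
  exact: nbhs_right_gt.
exact: nbhs_right_lt.
Unshelve. all: by end_near. Qed.

Lemma cvg_right0P (f : R -> B) y : f t @[t --> 0^'+] --> y <->
  forall e, 0 < e -> exists2 d, 0 < d & forall t, 0 < t < d -> N (y - f t) < e.
Proof.
by split=> [/(cvg_rnormP hK) fy e /fy/near_right0P|fy];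
  last by apply/(cvg_rnormP hK) => e /fy/near_right0P.
Qed.

(** Turns the error of a difference quotient into the remainder of a first-order expansion, free of
    division. *)
Lemma rnormVZ t x y : 0 < `|t| -> N (x - (iota t)^-1 *: y) = `|t|^-1 * N (y - t ** x).
Proof.
move=> t0; have t0' : t != 0 by rewrite -normr_gt0.
rewrite (rnormBC re y) -normfV -(rnormZ hK).
by rewrite fmorphV scalerBr !scalerA mulVf ?fmorph_eq0// scale1r.
Qed.

Lemma strong_derivative0P (F : R -> {linear B -> B}) x y : (forall x, F 0 x = x) ->
  strong_derivative0 iota F (x, y) <-> forall e, 0 < e ->
  exists2 d, 0 < d & forall t, 0 < t < d -> N (F t x - x - t ** y) < t * e.
Proof.
move=> F0; apply: (iff_trans (cvg_right0P _ _)) => /=.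
split=> h e /h[d d0 hd]; exists d => // t /[dup] td /hd;
  have t0 : 0 < t by [case/andP: td]; rewrite F0 rnormVZ ?normr_gt0 ?gt_eqF// gtr0_norm//;
  by rewrite ltr_pdivrMl.
Qed.

Lemma derivative_onP l (f : R -> B) s y : 0 <= s < l ->
  derivative_on iota l f s y -> forall e, 0 < e ->
  exists2 d, 0 < d & forall t, 0 <= t < l -> `|t - s| <= d ->
    N (f t - f s - (t - s) ** y) <= `|t - s| * e.
Proof.
move=> sl /(cvg_rnormP hK) fy e /fy.
rewrite near_withinE.
(* Halving the radius puts the closed ball inside the open one. The centre [t = s], excluded from
   the punctured neighbourhood, is treated apart. *)
move=> -[d /= d0 dP]; exists (d / 2); first by rewrite divr_gt0.
move=> t tl td; have [->|ts] := eqVneq t s.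
  by rewrite subrr subrr rmorph0 scale0r subrr normr0 mul0r (rnorm0 hK).
have ts0 : 0 < `|t - s| by rewrite normr_gt0 subr_eq0.
have := dP t; rewrite /= in_itv/= tl ts => /(_ _ isT isT).
rewrite rnormVZ// ltr_pdivrMl// distrC => h; apply/ltW/h.
by move: td d0; rewrite distrC; lra.
Qed.

End RealNormTopology.

(** Take for tag the supremum of the good points of [0, T]. A good point just to its left yields the
    good point [Num.min T (sup S + d)], which can stay below the supremum only if it is [T]. The
    gauge [d] may depend on [s] without any uniform lower bound. *)
Lemma real_induction (R : realType) (Q : R -> Prop) (T : R) : 0 <= T -> Q 0 ->
  (forall s, 0 <= s <= T -> exists2 d, 0 < d & forall a b,
     0 <= a <= s -> s <= b <= T -> s - d <= a -> b <= s + d -> Q a -> Q b) ->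
  Q T.
Proof.
move=> T0 Q0 Qstep; pose S := [set a | 0 <= a <= T /\ Q a].
have S0 : S 0 by split=> //=; rewrite lexx.
have hS : has_sup S by split; [exists 0|exists T => a [/andP[]]].
have supS a : S a -> a <= sup S by move=> Sa; apply: ub_le_sup => //; case: hS.
have sT : 0 <= sup S <= T.
  by rewrite supS//=; apply: ge_sup; [exists 0|move=> a [/andP[]]].
have [d d0 Qd] := Qstep _ sT.
have [a Sa da] := sup_adherent d0 hS.
pose b := Num.min T (sup S + d).
have bT : b <= T by rewrite ge_min lexx.
have sb : sup S <= b by rewrite le_min; case/andP: sT => _ ->; lra.
have Qb : Q b.
  apply: (Qd a) => //; first by rewrite supS// andbT; case: Sa => /andP[].
  - by rewrite sb.
  - exact: ltW.
  - by rewrite ge_min lexx orbT.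
  - by case: Sa.
have Sb : S b by split=> //; rewrite bT andbT; case/andP: sT => /le_trans -> //.
move: (supS _ Sb) Qb; rewrite {1 2}/b; case: (leP T (sup S + d)) => [//|_]; lra.
Qed.

(** Here [t] is the mesh of a grid, [x] its last point up to [a], and [x'] a grid point in ]a, b].
    As [x] may precede [a], by less than [t], the gauge [m / 2] grows to [m] and the length [b - a]
    at most doubles. *)
Lemma tagged_interval_bounds (R : realFieldType) (s a b m t x x' : R) :
  a <= s -> s <= b -> s - m / 2 <= a -> b <= s + m / 2 -> t < m / 2 ->
  t < b - a -> x <= a -> a < x + t -> a < x' -> x' <= b ->
  [/\ `|x - s| <= m, `|x' - s| <= m,
     `|x - s| <= 2 * (b - a), `|x' - s| <= 2 * (b - a)
     & x' - x <= 2 * (b - a) /\ x' - x <= 2 * m].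
Proof. by move=> *; do !split; rewrite ?ler_norml; lra. Qed.

(** * Linearity of the iterates of a linear map *)

Section Iterates.
Variables (K : numFieldType) (B : lmodType K).

Lemma iter_is_linear n (T : {linear B -> B}) : linear (iter n T).
Proof. by elim: n => // n IHn a x y /=; rewrite IHn linearP. Qed.

HB.instance Definition _ n (T : {linear B -> B}) :=
  GRing.isLinear.Build K B B _ (iter n T) (iter_is_linear n T).

End Iterates.

(** * Chernoff approximation along a solution that is only differentiable *)

Section Chernoff.
Variables (R : realType) (K : numFieldType).
Variables (iota : {rmorphism R -> K}) (conj : {rmorphism K -> K}) (re : K -> R).
Hypothesis hK : scalar_field iota conj re.
Variable B : completeNormedModType K.
Implicit Types (x y : B) (r s t a b d e eta : R).
Local Notation N := (rnorm re).
Local Notation "r ** x" := (iota r *: x) (at level 40).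

Variables (F : R -> {linear B -> B}) (Z : set (B * B)) (T M : R).
Hypothesis M1 : 1 <= M.
Hypothesis FM : forall t n x, 0 < t -> n%:R * t <= T ->
  N (iter n (F t) x) <= M * N x.
Hypothesis FZ : forall x z, Z (x, z) -> forall e, 0 < e ->
  exists2 d, 0 < d & forall t, 0 < t < d -> N (F t x - x - t ** z) <= t * e.
Hypothesis Zdense : forall x e, 0 < e ->
  exists g z, Z (g, z) /\ N (x - g) < e.

Let M0 : 0 < M. Proof. exact: lt_le_trans M1. Qed.

(** Telescoping: each of the [n] increments is a power of [F t] applied to [F t g - g], whose norm
    is at most [t * (N z + 1)] for small [t]. *)
Lemma iter_increment g z : Z (g, z) -> exists2 d, 0 < d &
  forall t n, 0 < t < d -> n%:R * t <= T ->
    N (iter n (F t) g - g) <= n%:R * t * (M * (N z + 1)).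
Proof.
move=> /FZ /(_ 1 ltr01)[d d0 Fd]; exists d => // t n td.
have t0 : 0 < t by case/andP: td.
elim: n => [|n IHn]; first by rewrite !mul0r subrr (rnorm0 hK).
rewrite -natr1 mulrDl mul1r => nT.
have nT' : n%:R * t <= T by lra.
have -> : iter n.+1 (F t) g - g =
    iter n (F t) (F t g - g) + (iter n (F t) g - g).
  by rewrite linearB /= -iterSr addrA subrK.
rewrite (le_trans (rnormD hK _ _))// [leRHS]mulrDl addrC lerD ?IHn//.
rewrite (le_trans (FM _ t0 nT'))// mulrCA ler_pM2l//.
rewrite -[F t g - g](subrK (t ** z)) (le_trans (rnormD hK _ _))//.
by rewrite mulrDr addrC lerD ?Fd// (rnormZ hK) gtr0_norm.
Qed.

Lemma iter_continuous y e : 0 < e -> exists2 d, 0 < d &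
  forall t n, 0 < t < d -> n%:R * t <= d -> n%:R * t <= T ->
    N (iter n (F t) y - y) <= e.
Proof.
(* Replacing [y] by a nearby [g] in the domain of [Z] costs [(M + 1) * N (y - g)], which this choice
   keeps below [e / 2]; the other half is the increment at [g]. *)
move=> e0; pose e' := e / (2 * (M + 1)).
have e'0 : 0 < e' by rewrite divr_gt0// mulr_gt0// ltr_pwDl// ltW.
have [g [z [Zgz yg]]] := Zdense y e'0.
have [d d0 Fd] := iter_increment Zgz.
pose c := M * (N z + 1).
have c0 : 0 < c by rewrite mulr_gt0// ltr_wpDl// (rnorm_ge0 hK).
exists (Num.min d (e / (2 * c))).
  by rewrite lt_min d0 divr_gt0// mulr_gt0.
move=> t n; rewrite lt_min le_min => /and3P[t0 td _] /andP[_ ntc] nT.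
have -> : iter n (F t) y - y =
    iter n (F t) (y - g) + (iter n (F t) g - g) - (y - g).
  by rewrite linearB /= addrA subrK opprB addrA subrK.
have h1 : N (iter n (F t) g - g) <= e / 2.
  rewrite (le_trans (Fd t n _ nT)) ?t0// -/c.
  by rewrite -ler_pdivlMr// (le_trans ntc)// invfM mulrA.
have h2 := FM (y - g) t0 nT.
have h3 : (M + 1) * N (y - g) <= e / 2.
  rewrite (le_trans (ler_wpM2l _ (ltW yg)))//; first by rewrite addr_ge0// ltW.
  by rewrite /e' [leLHS]mulrCA invfM [X in _ * X]mulrCA divff ?mulr1// gt_eqF// addr_gt0.
have := rnormB hK (iter n (F t) (y - g) + (iter n (F t) g - g)) (y - g).
have := rnormD hK (iter n (F t) (y - g)) (iter n (F t) g - g).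
lra.
Qed.

(** The pair is approximated by a point of the graph of [Z], where telescoping applies. The order of
    quantifiers matters: the range [d] of times is fixed before [eta], and only the mesh bound [d']
    depends on the quality of the approximation. *)
Lemma iter_closure_generator x y e : closure Z (x, y) -> 0 < e ->
  exists2 d, 0 < d & forall eta, 0 < eta -> exists2 d', 0 < d' &
  forall t n, 0 < t < d' -> n%:R * t <= d -> n%:R * t <= T ->
    N (iter n (F t) x - x - (n%:R * t) ** y) <= eta + n%:R * t * e /\
    N (iter n (F t) y - y) <= e.
Proof.
move=> Zxy e0.
have e40 : 0 < e / (4 * M) by rewrite divr_gt0// mulr_gt0.
have e20 : 0 < e / 2 by rewrite divr_gt0.
have [d d0 Fd] := iter_continuous y e20.
exists d => // eta eta0.
(* The first bound keeps the cost of replacing [z] by [y] in each step at [t * e / 4], even after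
   multiplication by [M]; the second keeps the cost of replacing [x] by [g] below [eta]. *)
pose e' := Num.min (e / (4 * M)) (eta / (M + 1)).
have e'0 : 0 < e' by rewrite lt_min e40 divr_gt0// addr_gt0.
have [g [z [Zgz xg yz]]] := closure_rnorm hK Zxy e'0.
have [d1 d10 Fd1] := FZ Zgz e40.
exists (Num.min d d1); first by rewrite lt_min d0.
move=> t n; rewrite lt_min => /and3P[t0 td td1] nd nT.
have Fy k : (k <= n)%N -> N (iter k (F t) y - y) <= e / 2.
  move=> kn; have : k%:R * t <= n%:R * t by rewrite ler_pM2r// ler_nat.
  by move=> knt; apply: Fd; rewrite ?t0//=; lra.
split; last by have := Fy n (leqnn n); lra.
have Fg k : (k <= n)%N ->
    N (iter k (F t) g - g - (k%:R * t) ** y) <= k%:R * t * e.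
  elim: k => [|k IHk] kn; first by rewrite !mul0r !rmorph0 scale0r subrr subr0 (rnorm0 hK).
  (* The new step contributes the consistency error at [g], with [z] corrected to [y], carried by
     the [k]-th power, and the drift of the iterates at [y]; each is at most [t * e / 2]. *)
  have -> : iter k.+1 (F t) g - g - (k.+1%:R * t) ** y =
      iter k (F t) ((F t g - g - t ** z) - t ** (y - z))
      + t ** (iter k (F t) y - y) + (iter k (F t) g - g - (k%:R * t) ** y).
    rewrite -natr1 mulrDl mul1r rmorphD scalerDl.
    have -> : F t g - g - t ** z - t ** (y - z) = F t g - g - t ** y.
      by rewrite scalerBr opprB addrA subrK.
    rewrite [iter k _ (_ - _)]linearB /= [iter k _ (_ - _)]linearB /= linearZ /= -iterSr scalerBr.
    set w := _ *: iter k _ y; rewrite [_ + (w - _)]addrA subrK.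
    rewrite iterS; set P := iter k _ g; rewrite (addrAC _ (- P)) !addrA subrK.
    by rewrite opprD addrA (addrAC _ _ (- g)) [RHS]addrAC.
  have kt0 : k%:R * t <= n%:R * t by rewrite ler_pM2r// ler_nat ltnW.
  have ktT : k%:R * t <= T by lra.
  have h1 := rnormD hK (iter k (F t) ((F t g - g - t ** z) - t ** (y - z))
      + t ** (iter k (F t) y - y)) (iter k (F t) g - g - (k%:R * t) ** y).
  have h2 := rnormD hK (iter k (F t) ((F t g - g - t ** z) - t ** (y - z)))
      (t ** (iter k (F t) y - y)).
  have h3 := FM ((F t g - g - t ** z) - t ** (y - z)) t0 ktT.
  have h4 := rnormB hK (F t g - g - t ** z) (t ** (y - z)).
  have h5 : N (t ** (iter k (F t) y - y)) <= t * (e / 2).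
    by rewrite (rnormZ hK) gtr0_norm// ler_pM2l// Fy// ltnW.
  have h6 : N (t ** (y - z)) <= t * (e / (4 * M)).
    rewrite (rnormZ hK) gtr0_norm// ler_pM2l// (le_trans (ltW yz))//.
    by rewrite ge_min lexx.
  have h7 : N (F t g - g - t ** z) <= t * (e / (4 * M)) by apply: Fd1; rewrite t0.
  have h8 : M * N ((F t g - g - t ** z) - t ** (y - z)) <= t * (e / 2).
    rewrite -ler_pdivlMl//.
    have -> : M^-1 * (t * (e / 2)) = t * (e / (4 * M)) + t * (e / (4 * M)).
      by field; rewrite gt_eqF.
    by rewrite (le_trans h4)// lerD.
  rewrite -natr1 mulrDl mulrDl mul1r.
  have := IHk (ltnW kn); lra.
have -> : iter n (F t) x - x - (n%:R * t) ** y =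
    iter n (F t) (x - g) + (iter n (F t) g - g - (n%:R * t) ** y) - (x - g).
  rewrite linearB /= !addrA subrK opprB addrA.
  by rewrite (addrAC _ (- (_ *: y)) g) subrK [RHS]addrAC.
have h1 := rnormB hK (iter n (F t) (x - g) +
  (iter n (F t) g - g - (n%:R * t) ** y)) (x - g).
have h2 := rnormD hK (iter n (F t) (x - g)) (iter n (F t) g - g - (n%:R * t) ** y).
have h3 := FM (x - g) t0 nT.
have h4 : (M + 1) * N (x - g) <= eta.
  rewrite mulrC -ler_pdivlMr ?addr_gt0// (le_trans (ltW xg))//.
  by rewrite ge_min lexx orbT.
have := Fg n (leqnn n); lra.
Qed.

(** Meant for [v] and [y] the value and derivative of the solution at a tag, and [w], [w'] its
    values at offsets [p], [q] from it. The first-order terms cancel because [q = n%:R * t + p]. The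
    factor [M + 1] comes from the remainder at [w], carried by the [n]-th power, and from the drift
    of [p ** y]. *)
Lemma iter_taylor_step n t p q a e (v w w' y : B) :
  0 < t -> n%:R * t <= T -> q = n%:R * t + p ->
  N (iter n (F t) v - v - (n%:R * t) ** y) <= a -> N (iter n (F t) y - y) <= e ->
  N (w - v - p ** y) <= `|p| * e -> N (w' - v - q ** y) <= `|q| * e ->
  N (iter n (F t) w - w') <= a + (M + 1) * `|p| * e + `|q| * e.
Proof.
move=> t0 nT qE hv hy hw hw'.
have -> : iter n (F t) w - w' =
    (iter n (F t) v - v - (n%:R * t) ** y) + p ** (iter n (F t) y - y)
    + iter n (F t) (w - v - p ** y) - (w' - v - q ** y).
  rewrite [iter n _ (_ - _)]linearB /= [iter n _ (_ - _)]linearB /=.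
  rewrite [iter n _ (_ *: _)]linearZ /=.
  rewrite qE rmorphD scalerDl scalerBr; set c := (n%:R * t) ** y; set b := p ** y.
  set V := iter n _ v; set Y := p ** _; set W := iter n _ w.
  have -> : V - v - c + (Y - b) = (V + Y) - (v + (c + b)).
    by rewrite addrACA (addrAC V) !opprD !addrA.
  have -> : W - V - Y = W - (V + Y) by rewrite opprD addrA.
  have -> : w' - v - (c + b) = w' - (v + (c + b)) by rewrite [in RHS]opprD addrA.
  by rewrite [_ + (W - _)]addrC addrA subrK opprB addrA subrK.
have {}hw : N (iter n (F t) (w - v - p ** y)) <= M * (`|p| * e).
  by rewrite (le_trans (FM _ t0 nT))// ler_pM2l.
have {}hy : N (p ** (iter n (F t) y - y)) <= `|p| * e.
  by rewrite (rnormZ hK) ler_wpM2l.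
set E := w' - v - _ in hw' *; set P := p ** _ in hy *.
set A := _ - v - _ in hv *; set W := iter n _ _ in hw *.
have := rnormB hK (A + P + W) E; have := rnormD hK (A + P) W.
have := rnormD hK A P; lra.
Qed.

Variables (l e : R) (h : B) (f : R -> B).
Hypothesis T0 : 0 <= T < l.
Hypothesis e0 : 0 < e.
Hypothesis sol : local_solution iota (closure Z) l h f.

(** The sum 1 + 2 + 2 (M + 1) + 2 of the errors made on one interval, times the [M] that bounds the
    trailing power. *)
Local Notation C := (M * (2 * M + 7)).

(* Quantifying over all j lets consecutive intervals be chained without
   multiplying the constant M at each step. *)
Definition close_upto s := exists2 d, 0 < d & forall t j k,
  0 < t < d -> k%:R * t <= s -> (k + j)%:R * t <= T ->
  N (iter j (F t) (iter k (F t) h - f (k%:R * t))) <= C * e * s.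

Lemma solution_step s : 0 <= s <= T -> exists2 d, 0 < d & forall a b,
  0 <= a <= s -> s <= b <= T -> s - d <= a -> b <= s + d ->
  close_upto a -> close_upto b.
Proof.
have /andP[T00 Tl] := T0; have [M00 e00] := (M0, e0).
move=> /andP[s0 sT]; have sl : 0 <= s < l by rewrite s0 (le_lt_trans sT).
have [_ _ /(_ s sl) [y Zy /(derivative_onP hK sl) fy]] := sol.
have [d1 d10 fd1] := fy _ e0.
have [d2 d20 Fd2] := iter_closure_generator Zy e0.
(* The grid points used lie within [m] of [s], hence within [d1], and at most [2 * m <= d2]
   apart. *)
exists (Num.min d1 (d2 / 2) / 2); first by rewrite !divr_gt0// lt_min d10 divr_gt0.
set m := Num.min _ _ => a b /andP[a0 as_] /andP[sb bT] sma bsm Qa.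
have m0 : 0 < m by rewrite lt_min d10 divr_gt0.
have md1 : m <= d1 by rewrite ge_min lexx.
have md2 : 2 * m <= d2 by rewrite mulrC -ler_pdivlMr// ge_min lexx orbT.
have [ab|ab] := eqVneq a b; first by rewrite -ab.
have {}ab : 0 < b - a by rewrite subr_gt0 lt_neqAle ab; exact: le_trans sb.
(* Taking [eta := e * (b - a)] makes the additive error proportional to the length of the interval;
   this is allowed because [d2] was fixed before [eta]. *)
have [d3 d30 Fd3] := Fd2 _ (mulr_gt0 e0 ab).
have [d4 d40 Qa4] := Qa.
exists (Num.min (Num.min d3 d4) (Num.min (m / 2) (b - a))).
  by rewrite !lt_min d30 d40 divr_gt0.
move=> t j k; rewrite !lt_min => /and3P[t0 /andP[td3 td4] /andP[tm tba]] kb kjT.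
have C0 : 0 < C by rewrite mulr_gt0// addr_gt0// mulr_gt0.
have [ka|ak] := leP (k%:R * t) a.
  apply: (le_trans (Qa4 _ _ _ _ ka kjT)); first by rewrite t0.
  by rewrite ler_pM2l 1?mulr_gt0//; exact: le_trans sb.
have [n na an] : exists2 n : nat, n%:R * t <= a & a < n%:R * t + t.
  have := truncn_itv (divr_ge0 a0 (ltW t0)).
  rewrite ler_pdivlMr// ltr_pdivrMr// -natr1 mulrDl mul1r => /andP[? ?].
  by exists (Num.truncn (a / t)).
have nk : (n <= k)%N by rewrite -(ler_nat R) -(ler_pM2r t0) (le_trans na)// ltW.
pose i := (k - n)%N.
have kE : k = (i + n)%N by rewrite subnK.
have it : i%:R * t = k%:R * t - n%:R * t by rewrite natrB// mulrBl.
have nt0 : 0 <= n%:R * t by rewrite mulr_ge0// ltW.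
have kT : k%:R * t <= T by rewrite (le_trans kb).
have jT : j%:R * t <= T.
  by rewrite (le_trans _ kjT)// ler_pM2r// ler_nat leq_addl.
set x := n%:R * t in na an it nt0 *; set x' := k%:R * t in kb it ak kT *.
(* The error at [x'] splits into the error inherited from [x], carried by [j + i] steps, and the
   local error between [x] and [x'], carried by [j] steps. *)
have -> : iter j (F t) (iter k (F t) h - f x') =
    iter (j + i) (F t) (iter n (F t) h - f x)
    + iter j (F t) (iter i (F t) (f x) - f x').
  rewrite kE !iterD -[RHS]linearD; congr (iter j (F t) _).
  by rewrite linearB /= addrA subrK.
(* The hypothesis at [a], used with [j + i] trailing steps, brings in no new factor [M]. *)
have Qn : N (iter (j + i) (F t) (iter n (F t) h - f x)) <= C * e * a.
  apply: Qa4 => //; first by rewrite t0.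
  by rewrite addnC -addnA -kE addnC.
have [xm x'm xs xs' [it2 itm]] := tagged_interval_bounds as_ sb sma bsm tm tba na an ak kb.
have [Fs Fy] : N (iter i (F t) (f s) - f s - (i%:R * t) ** y) <=
      e * (b - a) + i%:R * t * e /\ N (iter i (F t) y - y) <= e.
  apply: Fd3; rewrite ?t0// it; first exact: le_trans md2.
  by rewrite (le_trans _ kT)// lerBlDr lerDl.
have fx : N (f x - f s - (x - s) ** y) <= `|x - s| * e.
  apply: fd1; last exact: le_trans md1.
  by rewrite nt0 (le_lt_trans na)// (le_lt_trans as_)// (le_lt_trans sT).
have fx' : N (f x' - f s - (x' - s) ** y) <= `|x' - s| * e.
  apply: fd1; last exact: le_trans md1.
  by rewrite (le_lt_trans kT)// andbT mulr_ge0// ltW.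
have Ffx : N (iter i (F t) (f x) - f x') <= (2 * M + 7) * e * (b - a).
  have h1 : (M + 1) * `|x - s| * e <= (M + 1) * (2 * (b - a)) * e.
    by rewrite ler_pM2r// ler_pM2l// addr_gt0.
  have h2 : `|x' - s| * e <= 2 * (b - a) * e by rewrite ler_pM2r.
  have h3 : i%:R * t * e <= 2 * (b - a) * e by rewrite ler_pM2r// it.
  have h4 : i%:R * t <= T by rewrite it (le_trans _ kT)// lerBlDr lerDl.
  have step : x' - s = i%:R * t + (x - s) by rewrite it addrA subrK.
  apply: le_trans (iter_taylor_step t0 h4 step Fs Fy fx fx') _.
  apply: (@le_trans _ _ (e * (b - a) + 2 * (b - a) * e
      + (M + 1) * (2 * (b - a)) * e + 2 * (b - a) * e)); first by rewrite !lerD.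
  by rewrite le_eqVlt; apply/orP; left; apply/eqP; ring.
have -> : C * e * b = C * e * a + M * ((2 * M + 7) * e * (b - a)).
  by ring.
rewrite (le_trans (rnormD hK _ _))// lerD//.
by rewrite (le_trans (FM _ t0 jT))// ler_pM2l.
Qed.

Lemma solution_approx : exists2 d, 0 < d & forall t k,
  0 < t < d -> k%:R * t <= T -> N (iter k (F t) h - f (k%:R * t)) <= C * e * T.
Proof.
have : close_upto T.
  apply: (@real_induction _ close_upto); first by case/andP: T0.
    exists 1 => // t j k /andP[t0 _] + _; rewrite pmulr_lle0// => k0.
    move: k0; rewrite lern0 => /eqP ->.
    by have [_ <- _] := sol; rewrite mul0r subrr linear0 (rnorm0 hK) mulr0.
  exact: solution_step.
move=> [d d0 Qd]; exists d => // t k td kT.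
by apply: (Qd t 0%N k) => //; rewrite addn0.
Qed.

End Chernoff.

(** The first-variation argument: at [t = r / (c + 1)] the inequality bounds a positive multiple of
    [r ^+ 2] by 0. *)
Lemma linear_le_quadratic_eq0 (R : realFieldType) (r c : R) :
  (forall t, 2 * t * r <= t ^+ 2 * c) -> r = 0.
Proof.
move=> h; apply/eqP; rewrite -sqrf_eq0 eq_le sqr_ge0 andbT.
have c0 : 0 <= c by have := h 1; have := h (-1); rewrite sqrrN expr1n; lra.
have c1 : 0 < c + 1 by rewrite ltr_wpDl.
have := h (r / (c + 1)); rewrite -subr_ge0.
have -> : (r / (c + 1)) ^+ 2 * c - 2 * (r / (c + 1)) * r =
    - (r ^+ 2 * ((c + 2) / (c + 1) ^+ 2)) by field; rewrite gt_eqF.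
by rewrite oppr_ge0 pmulr_lle0// divr_gt0 ?exprn_gt0// ltr_wpDl.
Qed.

(** * Geometry of the real part of the inner product *)

Section InnerProduct.
Variables (R : realType) (K : numFieldType).
Variables (iota : {rmorphism R -> K}) (conj : {rmorphism K -> K}) (re : K -> R).
Hypothesis hK : scalar_field iota conj re.
Variables (B : completeNormedModType K) (ip : {dot B for conj}).
Hypothesis hB : induces_norm ip.
Implicit Types (x y u v : B) (r s t e d : R).
Local Notation N := (rnorm re).
Local Notation "r ** x" := (iota r *: x) (at level 40).
Local Notation rip x y := (re (ip x y)).

Lemma ripC x y : rip x y = rip y x.
Proof. by rewrite hermC expr0 mul1r (re_conj hK). Qed.

Lemma ripDl x y v : rip (x + y) v = rip x v + rip y v.
Proof. by rewrite linearDl (reD hK). Qed.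

Lemma ripZl r x v : rip (r ** x) v = r * rip x v.
Proof. by rewrite linearZl_LR /= (re_iotaM hK). Qed.

Lemma rip_adjoint (a : K) x v : rip (a *: x) v = rip x (conj a *: v).
Proof.
by rewrite linearZl_LR -[in RHS]/(applyr ip _ _) /= [in RHS]linearZ_LR /= (conjK hK).
Qed.

Lemma ripxx x : rip x x = N x ^+ 2.
Proof. by rewrite hB -(iota_rnorm hK) -rmorphXn /= (re_iota hK). Qed.

Lemma rnormDZ_sqr x y t :
  N (x + t ** y) ^+ 2 = N x ^+ 2 + 2 * t * rip x y + t ^+ 2 * N y ^+ 2.
Proof.
rewrite -!ripxx ripDl ![rip _ (x + _)]ripC !ripDl ripZl !(ripC _ (t ** y)) !ripZl.
by rewrite (ripC y (t ** y)) ripZl (ripC y x); ring.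
Qed.

Lemma rnormD_sqr x y : N (x + y) ^+ 2 = N x ^+ 2 + 2 * rip x y + N y ^+ 2.
Proof.
by have := rnormDZ_sqr x y 1; rewrite rmorph1 scale1r mulr1 expr1n mul1r.
Qed.

(** Cauchy-Schwarz, read off by squaring the triangle inequality. *)
Lemma rip_le x y : rip x y <= N x * N y.
Proof.
have : N (x + y) ^+ 2 <= (N x + N y) ^+ 2.
  by rewrite ler_sqr ?nnegrE ?addr_ge0 ?(rnorm_ge0 hK)// (rnormD hK).
by rewrite rnormD_sqr sqrrD mulr_natl -mulr_natl; lra.
Qed.

Lemma parallelogram x y :
  N (x - y) ^+ 2 = 2 * N x ^+ 2 + 2 * N y ^+ 2 - 4 * N (2^-1 ** (x + y)) ^+ 2.
Proof.
rewrite (rnormZ hK) ger0_norm ?invr_ge0// exprMn (rnormD_sqr x y).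
have := rnormDZ_sqr x y (-1).
by rewrite rmorphN1 scaleN1r sqrrN expr1n => ->; field.
Qed.

(** * Orthogonal projection and extension for a contractive linear relation *)

Variable G : set (B * B).
Hypothesis G0 : G 0.
Hypothesis Glin : forall (a : K) p q, G p -> G q -> G (a *: p + q).
Hypothesis Gle : forall u x, G (u, x) -> N x <= N u.

Let GZD (a : K) u x v w : G (u, x) -> G (v, w) -> G (a *: u + v, a *: x + w).
Proof. exact: Glin. Qed.

Let Gsub u x v w : G (u, x) -> G (v, w) -> G (u - v, x - w).
Proof.
by move=> Gu Gv; have := GZD (-1) Gv Gu; rewrite !scaleN1r ![- _ + _]addrC.
Qed.

Lemma closure_contraction u x : closure G (u, x) -> N x <= N u.
Proof.
move=> Gux; apply/ler_addgt0Pr => e e0.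
have e20 : 0 < e / 2 by rewrite divr_gt0.
have [v [w [Gvw uv xw]]] := closure_rnorm hK Gux e20.
have := Gle Gvw; have := rnormD hK (x - w) w; have := rnormB hK u (u - v).
by rewrite subKr subrK; lra.
Qed.

Lemma closure_submod (a : K) u x v w :
  closure G (u, x) -> closure G (v, w) -> closure G (a *: u + v, a *: x + w).
Proof.
move=> /(closure_rnormP hK) Gux /(closure_rnormP hK) Gvw.
apply/(closure_rnormP hK) => e e0; pose c := re `|a|.
have c0 : 0 <= c by rewrite -(ler_iota hK) rmorph0 (iota_re_ge0 hK).
have d0 : 0 < e / (c + 1) by rewrite divr_gt0// ltr_wpDl.
have [u' [x' [Gux' uu' xx']]] := Gux _ d0.
have [v' [w' [Gvw' vv' ww']]] := Gvw _ d0.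
have lin (z z' q q' : B) : N (z - z') < e / (c + 1) -> N (q - q') < e / (c + 1) ->
    N (a *: z + q - (a *: z' + q')) < e.
  move=> zz' qq'; rewrite opprD addrACA -scalerBr.
  rewrite (le_lt_trans (rnormD hK _ _))// (rnormZr hK) -/c.
  have -> : e = c * (e / (c + 1)) + e / (c + 1).
    by field; rewrite gt_eqF// ltr_wpDl.
  by rewrite ler_ltD// ler_wpM2l// ltW.
exists (a *: u' + v'), (a *: x' + w'); split; [exact: GZD|exact: lin|exact: lin].
Qed.

(** The projection [u] of [y] onto the closure of the domain of [G] and its image [x] are built
    together: along pairs of [G] that nearly minimise the distance to [y], first coordinates are
    Cauchy by the parallelogram law, hence so are the second ones, [G] being contractive. *)
Lemma best_approximation y : exists u x, closure G (u, x) /\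
  forall v w, G (v, w) -> rip (y - u) v = 0.
Proof.
pose dist := [set r | exists v w, G (v, w) /\ r = N (y - v)].
have hdist : has_inf dist.
  split; first by exists (N (y - 0)), 0, 0.
  by exists 0 => _ [v [w [_ ->]]]; rewrite (rnorm_ge0 hK).
pose m := inf dist.
have mle v w : G (v, w) -> m <= N (y - v).
  by move=> Gvw; apply: ge_inf; [case: hdist|exists v, w].
have m0 : 0 <= m.
  by apply: lb_le_inf; [case: hdist|move=> _ [v [w [_ ->]]]; rewrite (rnorm_ge0 hK)].
pose near_best e := [set p | G p /\ N (y - p.1) ^+ 2 < m ^+ 2 + e].
have near_best_ex e : 0 < e -> near_best e !=set0.
  (* With [d <= 1], [(m + d) ^+ 2] exceeds [m ^+ 2] by at most [d * (2 * m + 1) <= e]. *)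
  move=> e0; pose d := Num.min 1 (e / (2 * m + 1)).
  have m10 : 0 < 2 * m + 1 by rewrite ltr_wpDl// mulr_ge0.
  have d0 : 0 < d by rewrite lt_min ltr01 divr_gt0.
  have [_ [v [w [Gvw ->]]] vm] := inf_adherent d0 hdist.
  exists (v, w); split => //=.
  have d1 : d <= 1 by rewrite ge_min lexx.
  have de : d * (2 * m + 1) <= e by rewrite -ler_pdivlMr// ge_min lexx orbT.
  have : N (y - v) ^+ 2 < (m + d) ^+ 2.
    by rewrite ltr_sqr ?nnegrE ?(rnorm_ge0 hK)// addr_ge0// ltW.
  have : d ^+ 2 <= d by rewrite expr2 ler_piMr// ltW.
  rewrite sqrrD -mulr_natl; lra.
pose FG := filter_from [set e | 0 < e] near_best.
have FF : ProperFilter FG.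
  apply: filter_from_proper => //; apply: filter_from_filter; first by exists 1 => /=.
  move=> e d /= e0 d0; exists (Num.min e d); first by rewrite /= lt_min e0.
  move=> p [Gp pe]; split; split=> //; apply: (lt_le_trans pe);
    by rewrite lerD2l ge_min lexx ?orbT.
have near_best_close e p q : near_best e p -> near_best e q ->
    N (p.1 - q.1) ^+ 2 < 4 * e.
  case: p q => [u x] [v w] [Gux /= ue] [Gvw /= ve].
  (* The midpoint of [u] and [v] lies in the domain of [G], so its distance to [y] is at least
     [m]. *)
  have mid : m <= N (2^-1 ** (y - v + (y - u))).
    have := mle _ _ (GZD (iota 2^-1) (GZD 1 Gux Gvw) G0); congr (_ <= N _).
    rewrite scale1r addr0 addrACA -opprD [v + u]addrC [in RHS]scalerBr [_ *: (y + y)]scalerDr.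
    rewrite -scalerDl -rmorphD /= (_ : 2^-1 + 2^-1 = 1) ?rmorph1 ?scale1r//.
    by field.
  have := parallelogram (y - v) (y - u).
  rewrite opprB [y - v + (u - y)]addrC addrA subrK => ->.
  have : m ^+ 2 <= N (2^-1 ** (y - v + (y - u))) ^+ 2.
    by rewrite ler_sqr ?nnegrE ?(rnorm_ge0 hK).
  lra.
have near_best_dist e p q : 0 < e -> near_best (e ^+ 2 / 4) p ->
    near_best (e ^+ 2 / 4) q -> N (p.1 - q.1) < e.
  move=> e0 np nq; have := near_best_close _ _ _ np nq.
  have -> : 4 * (e ^+ 2 / 4) = e ^+ 2 by field.
  by rewrite ltr_sqr ?nnegrE ?(rnorm_ge0 hK) ?ltW.
have sqr4_gt0 e : 0 < e -> 0 < e ^+ 2 / 4 by move=> e0; rewrite divr_gt0// exprn_gt0.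
have cvgFG (f : B * B -> B) :
    (forall p q, G p -> G q -> N (f p - f q) <= N (p.1 - q.1)) -> cvg (f @ FG).
  move=> fle; apply/cauchy_cvgP/cauchy_exP => _ /(iota_gt0 hK)[e e0 <-].
  have [p np] := near_best_ex _ (sqr4_gt0 _ e0).
  exists (f p), (e ^+ 2 / 4) => [|q nq]; first exact: sqr4_gt0.
  rewrite -ball_normE /= -(iota_rnorm hK) (ltr_iota hK).
  by rewrite (le_lt_trans (fle _ _ np.1 nq.1))// near_best_dist.
have /(cvg_rnormP hK) u_lim : cvg (fst @ FG) by apply: cvgFG.
have /(cvg_rnormP hK) x_lim : cvg (snd @ FG).
  by apply: cvgFG => -[? ?] [? ?] Gp Gq; apply: Gle; exact: Gsub.
set u := lim _ in u_lim; set x := lim _ in x_lim; exists u, x.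
have approx e : 0 < e -> exists g z, [/\ G (g, z), N (y - g) < m + e,
    N (u - g) < e & N (x - z) < e].
  move=> e0; have ne : FG (near_best (e ^+ 2)) by exists (e ^+ 2) => //=; exact: exprn_gt0.
  have [[g z] [[[Ggz yg] ug] xz]] :=
    filter_ex (filterI (filterI ne (u_lim _ e0)) (x_lim _ e0)).
  have me : 0 <= m + e by rewrite addr_ge0// ltW.
  exists g, z; split=> //=; rewrite -ltr_sqr ?nnegrE ?(rnorm_ge0 hK)//.
  by rewrite (lt_le_trans yg)// sqrrD addrAC lerDl mulrn_wge0// mulr_ge0// ltW.
split.
  by apply/(closure_rnormP hK) => e /approx[g [z [Ggz _ ug xz]]]; exists g, z.
have yu : N (y - u) <= m.
  apply/ler_addgt0Pr => e e0; have e20 : 0 < e / 2 by rewrite divr_gt0.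
  have [g [z [_ yg ug _]]] := approx _ e20.
  by have := rnormB hK (y - g) (u - g); rewrite opprB addrA subrK; lra.
move=> v w Gvw; apply: (@linear_le_quadratic_eq0 _ _ (N v ^+ 2)) => t.
(* Since [u] is only a limit of points of the domain, minimality is transferred to [u + t ** v] by
   approximation. *)
have le_m : m <= N (y - u + (- t) ** v).
  apply/ler_addgt0Pr => e /approx[g [z [Ggz _ ug _]]].
  rewrite (le_trans (mle _ _ (GZD (iota t) Gvw Ggz)))//.
  have := rnormD hK (y - u + (- t) ** v) (u - g).
  rewrite rmorphN scaleNr addrAC addrA subrK -addrA -opprD [g + _]addrC; lra.
have : N (y - u) ^+ 2 <= N (y - u + (- t) ** v) ^+ 2.
  by rewrite ler_sqr ?nnegrE ?(rnorm_ge0 hK)// (le_trans yu).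
by rewrite rnormDZ_sqr sqrrN; lra.
Qed.

(* The relation H below is the sum of the closure of G and of the zero operator
   on the orthogonal complement of its domain. *)
Lemma contraction_extension : exists T : {linear B -> B},
  (forall u x, G (u, x) -> T u = x) /\ forall y, N (T y) <= N y.
Proof.
pose H y x := exists2 u, closure G (u, x) &
  forall v w, G (v, w) -> rip (y - u) v = 0.
have Hex y : exists x, H y x.
  by have [u [x [Gux ux]]] := best_approximation y; exists x, u.
have Hle y x : H y x -> N x <= N y.
  move=> [u Gux uy]; rewrite (le_trans (closure_contraction Gux))//.
  (* Orthogonality passes from the domain of [G] to its limit point [u]; Pythagoras then gives
     [N u <= N y]. *)
  have : - rip (y - u) u <= 0.
    apply/ler_addgt0Pr => e e0; rewrite add0r.
    have d0 : 0 < e / (N (y - u) + 1) by rewrite divr_gt0// ltr_wpDl// (rnorm_ge0 hK).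
    have [v [w [Gvw uv _]]] := closure_rnorm hK Gux d0.
    have := ripDl (v - u) u (y - u).
    rewrite subrK ripC (uy _ _ Gvw) [rip u _]ripC => vu.
    have -> : - rip (y - u) u = rip (v - u) (y - u) by lra.
    rewrite (le_trans (rip_le _ _))// (rnormBC re v).
    rewrite (le_trans (ler_wpM2r _ (ltW uv))) ?(rnorm_ge0 hK)//.
    by rewrite mulrAC ler_pdivrMr ?ltr_wpDl ?(rnorm_ge0 hK)// ler_pM2l// lerDl.
  move=> ripu0; have := rnormD_sqr (y - u) u; rewrite subrK => yE.
  rewrite -ler_sqr ?nnegrE ?(rnorm_ge0 hK)// yE.
  have := sqr_ge0 (N (y - u)); lra.
have HZD (a : K) y x y' x' : H y x -> H y' x' -> H (a *: y + y') (a *: x + x').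
  move=> [u Gux uy] [u' Gux' uy'].
  exists (a *: u + u'); first exact: closure_submod.
  move=> v w Gvw; rewrite opprD addrACA -scalerBr ripDl (uy' _ _ Gvw) addr0.
  (* Vanishing real parts suffice for complex scalars as well, because the domain of [G] is stable
     under multiplication by [conj a]. *)
  rewrite rip_adjoint; have := GZD (conj a) Gvw G0.
  by rewrite !addr0 => /uy.
have Hfun y x x' : H y x -> H y x' -> x = x'.
  move=> yx yx'; have := HZD (-1) _ _ _ _ yx' yx.
  rewrite !scaleN1r addNr => /Hle; rewrite (rnorm0 hK) => h.
  apply/eqP; rewrite -subr_eq0 addrC; apply/eqP/(rnorm_eq0 hK)/eqP.
  by rewrite eq_le h (rnorm_ge0 hK).
have [T HT] := choice Hex.
have Tlin : linear T by move=> a y y'; apply: Hfun (HT _) _; exact: HZD.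
pose L := GRing.isLinear.Build K B B _ T Tlin.
pose TL : {linear B -> B} := HB.pack T L.
exists TL; split=> [u x Gux|y]; last exact: Hle (HT y).
apply: Hfun (HT u) _; exists u; first exact: subset_closure.
by move=> v w _; rewrite subrr linear0l (re0 hK).
Qed.

End InnerProduct.

(** * Equicontinuity of powers as a uniform norm bound *)

Section OperatorClass.
Variables (R : realType) (K : numFieldType).
Variables (iota : {rmorphism R -> K}) (conj : {rmorphism K -> K}) (re : K -> R).
Hypothesis hK : scalar_field iota conj re.
Variable B : completeNormedModType K.
Implicit Types (x y : B) (r s t e d : R) (F : R -> {linear B -> B}).
Local Notation N := (rnorm re).
Local Notation "r ** x" := (iota r *: x) (at level 40).

Lemma entourage_rnormP (E : set (B * B)) : entourage E <->
  exists2 e, 0 < e & forall x y, N (x - y) < e -> E (x, y).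
Proof.
rewrite -entourage_ballE; split=> [[_ /= /(iota_gt0 hK)[e e0 <-] eE]|[e e0 eE]].
  exists e => // x y xy; apply: eE => /=.
  by rewrite -ball_normE /= -(iota_rnorm hK) (ltr_iota hK).
exists (iota e) => /=; first by rewrite -(rmorph0 iota) (ltr_iota hK).
move=> [x y] /=; rewrite -ball_normE /= -(iota_rnorm hK) (ltr_iota hK); exact: eE.
Qed.

Lemma contractions_class_E F :
  (forall t x, 0 <= t -> N (F t x) <= N x) -> (forall x, F 0 x = x) -> class_E F.
Proof.
move=> FN F0; split=> // [t t0|s _ x E /entourage_rnormP[e e0 eE]].
  rewrite /bounded_near; near=> M; apply: filterS (rnorm_near hK 0 (@ltr01 R)) => x.
  rewrite sub0r rnormN => /ltW x1 /=; apply: (@le_trans _ _ 1); last first.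
    by near: M; exact: nbhs_pinfty_ge.
  by rewrite -(rmorph1 iota) -(iota_rnorm hK) (ler_iota hK) (le_trans (FN _ _ t0)).
apply: filterS (rnorm_near hK x e0) => y xy _ [n [m [d [n0 d0 _ ->]]]] /=.
apply: eE; rewrite -linearB; apply: le_lt_trans xy.
elim: m => //= m; apply: le_trans; apply: FN.
by rewrite divr_ge0.
Unshelve. all: by end_near. Qed.

(** Equicontinuity at 0 yields a [d] such that the powers map the ball of radius [d] into the unit
    ball; rescaling [x] to norm [d / 2] gives the bound [2 / d], and the added 1 ensures
    [1 <= M]. *)
Lemma powers_bounded F T : class_E F -> 0 <= T -> exists2 M, 1 <= M &
  forall t n x, 0 < t -> n%:R * t <= T -> N (iter n (F t) x) <= M * N x.
Proof.
move=> [_ _ Feq] T0.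
have E1 : entourage [set p : B * B | N (p.1 - p.2) < 1].
  by apply/entourage_rnormP; exists 1.
have /(nbhs_rnorm hK)[d d0 Fd] := Feq T T0 0 _ E1.
exists (1 + 2 / d); first by rewrite lerDl divr_ge0// ltW.
move=> t n x t0 nT; have [->|x0] := eqVneq x 0.
  by rewrite linear0 (rnorm0 hK) mulr0.
have Nx : 0 < N x.
  rewrite lt_neqAle (rnorm_ge0 hK) andbT eq_sym; apply: contra_neq x0.
  exact: (rnorm_eq0 hK).
pose c := d / (2 * N x).
have c0 : 0 < c by rewrite divr_gt0// mulr_gt0.
have := Fd (c ** x); rewrite sub0r rnormN (rnormZ hK) gtr0_norm//.
have -> : c * N x = d / 2 by rewrite /c; field; rewrite gt_eqF.
rewrite ltr_pdivrMr// ltr_pMr// ltr1n => /(_ isT (iter n (F t))) /=.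
have pFn : powers F T (iter n (F t)).
  by exists 1%N, n, t; rewrite !divr1; split=> //; exact: ltW.
move=> /(_ pFn); rewrite linear0 sub0r rnormN linearZ /= (rnormZ hK) gtr0_norm//.
rewrite -ltr_pdivlMl// => /ltW /le_trans; apply.
rewrite mulr1 mulrDl mul1r -[leLHS]add0r; apply: lerD; first exact: ltW.
by rewrite /c invf_div mulrAC.
Qed.

End OperatorClass.

(** * Construction of F from a dissipative operator, and convergence to local solutions *)

Section Dissipative.
Variables (R : realType) (K : numFieldType).
Variables (iota : {rmorphism R -> K}) (conj : {rmorphism K -> K}) (re : K -> R).
Hypothesis hK : scalar_field iota conj re.
Variables (B : completeNormedModType K) (ip : {dot B for conj}).
Hypothesis hB : induces_norm ip.
Variable Z : set (B * B).
Hypotheses (hZ : linear_operator Z) (hZdense : dense (dom Z)).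
Hypothesis hZdiss : dissipative re ip Z.
Implicit Types (x y z : B) (t e d : R).
Local Notation N := (rnorm re).
Local Notation "r ** x" := (iota r *: x) (at level 40).

(** Dissipativity makes the cross term of [N (x - t ** z) ^+ 2] nonnegative, so [x - t ** z |-> x]
    is a contraction and extends to [B]. For negative [t] the identity is a placeholder, so that a
    choice over all of [R] is possible. *)
Lemma contractive_resolvent t : exists T : {linear B -> B}, 0 <= t ->
  (forall x z, Z (x, z) -> T (x - t ** z) = x) /\ forall y, N (T y) <= N y.
Proof.
have [t0|t0] := leP 0 t; last by exists idfun.
have [Z0 Zlin _] := hZ.
pose G := [set p : B * B | exists2 z, Z (p.2, z) & p.1 = p.2 - t ** z].
have [||u x [z /= Zxz ->]|T [TG TN]] := @contraction_extension _ _ _ _ _ hK _ _ hB G.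
- by exists 0; rewrite ?scaler0 ?subr0.
- move=> a p q [z Zz pE] [w Zw qE]; exists (a *: z + w); first exact: (Zlin a _ _ Zz Zw).
  by rewrite /= pE qE scalerBr scalerDr opprD addrACA !scalerA [a * _]mulrC.
- rewrite -ler_sqr ?nnegrE ?(rnorm_ge0 hK)// -scaleNr -rmorphN.
  rewrite (rnormDZ_sqr hK hB) sqrrN.
  have := hZdiss Zxz; rewrite (ripC hK) => xz.
  have := mulr_ge0_le0 t0 xz.
  have : 0 <= t ^+ 2 * N z ^+ 2 by rewrite mulr_ge0 ?sqr_ge0.
  lra.
by exists T => _; split=> // x z Zxz; apply: TG; exists z.
Qed.

Lemma dissipative_extension : exists F : R -> {linear B -> B},
  class_F iota F /\ extends_generator iota F Z.
Proof.
have [F FP] := choice contractive_resolvent.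
have FN t x : 0 <= t -> N (F t x) <= N x by move=> /FP[].
have FZ t x z : 0 <= t -> Z (x, z) -> F t (x - t ** z) = x by move=> /FP[+ _]; exact.
have [Z0 Zlin Zfun] := hZ.
have F_id_near t x z y : 0 <= t -> Z (x, z) ->
    N (F t y - y) <= 2 * N (y - x) + t * N z.
  move=> t0 Zxz; have Fx : F t x - x = t ** F t z.
    by rewrite -{2}(FZ t x z t0 Zxz) -linearB subKr linearZ.
  have -> : F t y - y = F t (y - x) - (y - x) + (F t x - x).
    by rewrite linearB /= opprB addrACA subrK [x - y - x]addrAC subrr add0r.
  have := rnormD hK (F t (y - x) - (y - x)) (F t x - x).
  have := rnormB hK (F t (y - x)) (y - x); have := FN t (y - x) t0.
  rewrite Fx (rnormZ hK) ger0_norm//.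
  have := ler_wpM2l t0 (FN t z t0); lra.
(* [F 0] is a contraction fixing the dense domain of [Z], hence the identity. *)
have F0 y : F 0 y = y.
  apply/eqP; rewrite -subr_eq0; apply/eqP/(rnorm_eq0 hK)/eqP.
  rewrite eq_le (rnorm_ge0 hK) andbT; apply/ler_addgt0Pr => e e0.
  have e20 : 0 < e / 2 by rewrite divr_gt0.
  have [x [z Zxz] yx] := dense_rnorm hK y hZdense e20.
  have := F_id_near 0 x z y (lexx 0) Zxz; lra.
have F_cvg y e : 0 < e -> exists2 d, 0 < d & forall t, 0 < t < d -> N (F t y - y) < e.
  move=> e0; have e40 : 0 < e / 4 by rewrite divr_gt0.
  have [x [z Zxz] yx] := dense_rnorm hK y hZdense e40.
  have z1 : 0 < N z + 1 by rewrite ltr_wpDl// (rnorm_ge0 hK).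
  exists (e / 2 / (N z + 1)); first by rewrite !divr_gt0.
  move=> t /andP[t0]; rewrite ltr_pdivlMr// mulrDr mulr1 => td.
  have := F_id_near t x z y (ltW t0) Zxz; lra.
have F_derivative x z : Z (x, z) -> strong_derivative0 iota F (x, z).
  move=> Zxz; apply/(strong_derivative0P hK) => // e /(F_cvg z)[d d0 Fd].
  exists d => // t /[dup] td /Fd; have t0 : 0 < t by case/andP: td.
  (* The remainder equals [t ** (F t z - z)], which is o(t) by strong continuity at [z]. *)
  rewrite -[in F t x](subrK (t ** z) x) linearD /= (FZ _ _ _ (ltW t0) Zxz).
  rewrite [x + _ - x]addrAC subrr add0r linearZ /= -scalerBr (rnormZ hK) gtr0_norm//.
  by rewrite ltr_pM2l.
have hE : class_E F by exact: (contractions_class_E hK).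
exists F; split.
  split=> // O OO0 Oo; have [x [Ox [z Zxz]]] := hZdense OO0 Oo.
  (* Constant families put the domain of [Z] inside [dom_mef F]. *)
  exists x; split=> //; exists (fun=> x); split; first exact: cvg_cst.
  by exists z; exact: F_derivative.
split; first by move=> x [z Zxz]; exists z; exact: F_derivative.
apply/seteqP; split=> [[x y] [/= xy [z Zxz]]|[x z] Zxz].
  suff -> : y = z by [].
  exact: (cvg_unique _ xy (F_derivative _ _ Zxz)).
by split; [exact: F_derivative|exists z].
Qed.

Lemma chernoff_local_solution (F : R -> {linear B -> B}) l h (f : R -> B) t0 :
  class_F iota F -> extends_generator iota F Z ->
  local_solution iota (closure Z) l h f -> 0 < t0 < l ->
  {uniform `[0, t0],
    (fun (n : nat) t => iter n (F (t / n%:R)) h) @ \oo --> f}.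
Proof.
move=> [hE _] [_ FZ] sol /andP[t00 t0l].
have [_ F0 _] := hE.
have [M M1 FM] := powers_bounded hK hE (ltW t00).
have FZ' x z : Z (x, z) -> forall e, 0 < e ->
    exists2 d, 0 < d & forall t, 0 < t < d -> N (F t x - x - t ** z) <= t * e.
  rewrite -{1}FZ => -[/(strong_derivative0P hK _ _ F0) Fxz _] e /Fxz[d d0 Fd].
  by exists d => // t /Fd /ltW.
have Zd x e : 0 < e -> exists g z, Z (g, z) /\ N (x - g) < e.
  by move=> /(dense_rnorm hK x hZdense)[g [z Zgz] xg]; exists g, z.
have f0 : f 0 = h by case: sol.
move=> P /uniform_nbhs[E [/(entourage_rnormP hK)[e e0 eE] EP]].
pose C := M * (2 * M + 7) * t0.
have C0 : 0 < C by rewrite !mulr_gt0 ?addr_gt0 ?mulr_gt0// (lt_le_trans ltr01 M1).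
(* [C] includes the factor [t0], so this tolerance makes the total error [e / 2]. *)
have e'0 : 0 < e / (2 * C) by rewrite divr_gt0// mulr_gt0.
have t0l' : 0 <= t0 < l by rewrite ltW.
have [d d0 fd] := solution_approx hK M1 FM FZ' Zd t0l' e'0 sol.
(* This bound on [n] gives [t / n%:R < d] for all [t] up to [t0] at once, whence uniformity. The
   estimate needs a positive mesh, so [t = 0] is settled by [F 0] being the identity. *)
have : \forall n \near \oo, t0 / d < n%:R by exact: nbhs_infty_gtr.
apply: filterS => n nd; apply: EP => t /=; rewrite in_itv/= => /andP[t_ge0 tt0].
apply: eE; rewrite (rnormBC re).
have n0 : 0 < n%:R :> R by rewrite (lt_trans _ nd)// divr_gt0.
have [->|t_neq0] := eqVneq t 0.
  rewrite mul0r f0 (_ : iter n (F 0) h = h) ?subrr ?(rnorm0 hK)//.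
  by elim: (n) => //= k ->; exact: F0.
have t_gt0 : 0 < t by rewrite lt_neqAle eq_sym t_neq0.
have tE : n%:R * (t / n%:R) = t by rewrite mulrC divfK// gt_eqF.
have := fd (t / n%:R) n; rewrite tE divr_gt0// => /(_ _ tt0) /= fn.
apply: le_lt_trans (fn _) _.
  by rewrite ltr_pdivrMr// mulrC -ltr_pdivrMr// (le_lt_trans _ nd)// ler_pM2r ?invr_gt0.
have -> : M * (2 * M + 7) * (e / (2 * C)) * t0 = e / 2.
  by rewrite mulrAC -/C; field; rewrite gt_eqF.
by rewrite ltr_pdivrMr// ltr_pMr// ltr1n.
Qed.

End Dissipative.

Theorem corollary9p4 (R : realType) (K : numFieldType)
    (iota : {rmorphism R -> K}) (conj : {rmorphism K -> K}) (re : K -> R)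
    (hK : scalar_field iota conj re)
    (B : completeNormedModType K) (ip : {dot B for conj})
    (hB : induces_norm ip)
    (Z : set (B * B)) (hZ : linear_operator Z)
    (hZdense : dense (dom Z)) (hZdiss : dissipative re ip Z) :
  (exists F : R -> {linear B -> B},
      class_F iota F /\ extends_generator iota F Z) /\
  (forall F : R -> {linear B -> B},
      class_F iota F -> extends_generator iota F Z ->
      forall (l : R) (h : B) (f : R -> B),
        0 < l -> local_solution iota (closure Z) l h f ->
        forall t0 : R, 0 < t0 < l ->
          {uniform `[0, t0],
            (fun (n : nat) (t : R) => iter n (F (t / n%:R)) h) @ \oo --> f}).
Proof.
split; first exact: (dissipative_extension hK hB hZ hZdense hZdiss).
move=> F hF FZ l h f _ sol t0 t0l.
exact: (chernoff_local_solution hK hZdense hF FZ sol).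
Qed.
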